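(* Let $T>0$ and let $V$ be a uniformly convex and uniformly smooth Banach space with dual space $V'$. Let $(f_n)_{n}\subset C([0,T],V)$ be a sequence and let $f\in C([0,T],V)$ be a function such that the following two properties hold: (1) $\|f_n(t)\|_V$ converges to $\|f(t)\|_V$ uniformly in $t\in[0,T]$ as $n\to\infty$; and (2) for every $\varphi\in C([0,T],V')$, $\langle\varphi(t),f_n(t)\rangle$ converges to $\langle\varphi(t),f(t)\rangle$ uniformly in $t\in[0,T]$ as $n\to\infty$. Then $f_n$ converges to $f$ in the norm of $C([0,T],V)$, i.e. $$\lim_{n\to\infty}\ \sup_{t\in[0,T]}\|f_n(t)-f(t)\|_V=0.$$
   Context: For a Banach space $V$, $V'$ denotes its topological dual with the dual norm, and $\langle\cdot,\cdot\rangle$ denotes the duality pairing between $V'$ and $V$. $C([0,T],V)$ and $C([0,T],V')$ denote the spaces of norm-continuous functions on $[0,T]$ with values in $V$ and $V'$, respectively, equipped with the supremum norm. A normed vector space $V$ is called uniformly convex if for all $\varepsilon>0$ there exists $\delta>0$ such that for all $x,y\in V$ with $\|x\|=\|y\|\le 1$ the following implication holds: $\|x-y\|\ge\varepsilon \Rightarrow \left\|\frac{x+y}{2}\right\|\le 1-\delta$. A normed vector space $V$ is called uniformly smooth if for all $\varepsilon>0$ there exists $\delta>0$ such that $\|x+y\|+\|x-y\|\le 2+\varepsilon\|y\|$ for all $x,y\in V$ with $\|x\|=1$ and $\|y\|\le\delta$. *)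

(* Defs.v *)
From HB Require Import structures.
From mathcomp Require Import all_boot all_order all_algebra.
From mathcomp Require Import all_classical all_reals all_analysis.

Set Implicit Arguments.
Unset Strict Implicit.
Unset Printing Implicit Defensive.

Import Order.TTheory GRing.Theory Num.Theory.
Import numFieldNormedType.Exports.

Local Open Scope classical_set_scope.
Local Open Scope ring_scope.

Definition uniformly_convex (R : realType) (V : normedModType R) : Prop :=
  forall eps : R, 0 < eps -> exists2 delta : R, 0 < delta &
    forall x y : V, `|x| = `|y| -> `|y| <= 1 ->
      eps <= `|x - y| -> `|2^-1 *: (x + y)| <= 1 - delta.

Definition uniformly_smooth (R : realType) (V : normedModType R) : Prop :=
  forall eps : R, 0 < eps -> exists2 delta : R, 0 < delta &
    forall x y : V, `|x| = 1 -> `|y| <= delta ->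
      `|x + y| + `|x - y| <= 2 + eps * `|y|.

Section dual_def.
Context {R : realType} (V : normedModType R).

(* The predicate lives on [V -> R^o], whose pointwise [lmodType R] structure
   the dual inherits as a submodule. *)
Definition continuous_linear : {pred V -> R^o} :=
  fun phi => `[< linear phi /\ continuous phi >].

Record dual := Dual {
  dual_fun :> V -> R^o ;
  dual_funP : dual_fun \in continuous_linear }.

HB.instance Definition _ := [isSub of dual for dual_fun].
HB.instance Definition _ := [Choice of dual by <:].

Lemma continuous_linearP (phi : V -> R^o) :
  reflect (linear phi /\ continuous phi) (phi \in continuous_linear).
Proof. exact: asboolP. Qed.

Fact continuous_linear_submod : submod_closed continuous_linear.
Proof.
split; first by apply/continuous_linearP; split => [a x y|x];
  [rewrite /GRing.zero/= scaler0 addr0 | exact: cst_continuous].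
move=> a phi psi /continuous_linearP[lphi cphi] /continuous_linearP[lpsi cpsi].
apply/continuous_linearP; split => [b x y|x].
  rewrite !fctE lphi lpsi !scalerDr !scalerA (mulrC a b).
  by rewrite addrACA.
apply: (@continuousD R R^o V (a *: phi) psi); last exact: cpsi.
by apply: (@continuousM R V (cst a) phi); [exact: cst_continuous|exact: cphi].
Qed.

HB.instance Definition _ := GRing.isSubmodClosed.Build R (V -> R^o)
  continuous_linear continuous_linear_submod.
HB.instance Definition _ := [SubChoice_isSubLmodule of dual by <:].

(* A finite supremum by continuity of [phi] (see [dual_has_sup]). *)
Definition dual_norm (phi : dual) : R :=
  sup [set `|phi v| | v in [set v : V | `|v| <= 1]].

End dual_def.

Section dual_normed.
Context {R : realType} {V : normedModType R}.
Implicit Types phi psi : dual V.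

Lemma dual_linear phi : linear phi.
Proof. by have /continuous_linearP[] := dual_funP phi. Qed.

Lemma dual_continuous phi : continuous phi.
Proof. by have /continuous_linearP[] := dual_funP phi. Qed.

Lemma dualD phi psi v : (phi + psi) v = phi v + psi v.
Proof. by []. Qed.

Lemma dualZ (a : R) phi v : (a *: phi) v = a * phi v.
Proof. by []. Qed.

Lemma dual0v phi : phi 0 = 0.
Proof.
have := dual_linear phi 1 0 0; rewrite !scale1r addr0 => /eqP.
by rewrite -subr_eq subrr eq_sym => /eqP.
Qed.

Lemma dualZv phi (a : R) v : phi (a *: v) = a * phi v.
Proof. by have := dual_linear phi a v 0; rewrite dual0v !addr0. Qed.

Lemma dual_has_sup phi :
  has_sup [set `|phi v| | v in [set v : V | `|v| <= 1]].
Proof.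
split; first by exists `|phi 0|, 0 => //=; rewrite normr0.
have : phi @ 0 --> phi 0 by exact: dual_continuous.
move=> /cvgrPdist_lt/(_ 1 ltr01); rewrite dual0v.
rewrite -nbhs_nearE => /nbhs_normP[d /= d0 dP].
exists (2 / d) => _ [v /= v1 <-].
have vd : `|0 - (d / 2) *: v| < d.
  rewrite sub0r normrN normrZ gtr0_norm ?divr_gt0//.
  rewrite (@le_lt_trans _ _ (d / 2 * 1)) ?ler_pM2l ?divr_gt0//.
  by rewrite mulr1 ltr_pdivrMr// ltr_pMr// ltr1n.
have /= := dP _ vd; rewrite dualZv sub0r normrN normrM gtr0_norm ?divr_gt0//.
by move=> /ltW; rewrite -ler_pdivlMl ?divr_gt0// invf_div mulr1.
Qed.

Lemma dual_norm_ub phi v : `|v| <= 1 -> `|phi v| <= dual_norm phi.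
Proof.
by move=> v1; apply: ub_le_sup; [case: (dual_has_sup phi)|exists v].
Qed.

Lemma dual_norm_le phi (M : R) :
  (forall v, `|v| <= 1 -> `|phi v| <= M) -> dual_norm phi <= M.
Proof.
move=> h; apply: ge_sup; first by case: (dual_has_sup phi).
by move=> _ [v v1 <-]; exact: h.
Qed.

Fact dual_ler_normD phi psi :
  dual_norm (phi + psi) <= dual_norm phi + dual_norm psi.
Proof.
apply: dual_norm_le => v v1; rewrite dualD (le_trans (ler_normD _ _))//.
by rewrite lerD// dual_norm_ub.
Qed.

Fact dual_normrZ (a : R) phi : dual_norm (a *: phi) = `|a| * dual_norm phi.
Proof.
apply/eqP; rewrite eq_le; apply/andP; split.
  apply: dual_norm_le => v v1; rewrite dualZ normrM.
  by rewrite ler_wpM2l// dual_norm_ub.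
have [->|a0] := eqVneq a 0.
  by rewrite normr0 mul0r (le_trans _ (dual_norm_ub _ (v := 0) _)) ?normr0.
rewrite -ler_pdivlMl ?normr_gt0//; apply: dual_norm_le => v v1.
by rewrite ler_pdivlMl ?normr_gt0// -normrM -dualZ dual_norm_ub.
Qed.

Fact dual_normr0_eq0 phi : dual_norm phi = 0 -> phi = 0.
Proof.
move=> phi0; apply: val_inj; apply/funext => v /=.
have [->|v0] := eqVneq v 0; first by rewrite dual0v.
have : `|phi (`|v|^-1 *: v)| <= 0.
  by rewrite -phi0 dual_norm_ub// normrZ normfV normr_id mulVf// normr_eq0.
by rewrite normr_le0 dualZv mulf_eq0 invr_eq0 normr_eq0 (negbTE v0) => /eqP.
Qed.

(* The topology of [dual V] is therefore the one of the dual norm. *)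
HB.instance Definition _ := Lmodule_isNormed.Build R (dual V)
  dual_ler_normD dual_normrZ dual_normr0_eq0.

End dual_normed.

(* Main.v *)
(* Let j(x) be the one-sided derivative of the norm at x. It is sublinear, and
   uniform smoothness makes it linear, so j(x) has norm at most 1 and takes the
   value |x| at x. Smoothness also makes j norm-to-norm continuous away from 0,
   so the duality map x |-> |x| j(x) is continuous everywhere and
   phi(t) = |f(t)| j(f(t)) is an admissible test function. Where |f(t)| is small,
   (1) alone makes |f_n(t) - f(t)| small. Elsewhere, (1) and (2) show that
   j(f(t)) almost attains its norm at f_n(t)/|f_n(t)| as well as attaining it at
   f(t)/|f(t)|, so their midpoint has norm close to 1 and uniform convexity makes
   them close, uniformly in t. *)

Require Import Defs.
From mathcomp Require Import all_boot all_order all_algebra.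
From mathcomp Require Import all_classical all_reals all_analysis.
From mathcomp Require Import ring lra.

Set Implicit Arguments.
Unset Strict Implicit.
Unset Printing Implicit Defensive.

Import Order.TTheory GRing.Theory Num.Theory.
Import numFieldNormedType.Exports.

Local Open Scope classical_set_scope.
Local Open Scope ring_scope.

(** * One-sided directional derivative of the norm *)

Section norm_slope.
Context {R : realType} {V : normedModType R}.
Implicit Types (x v w : V) (s t a : R).

Definition norm_slope x v s : R := (`|x + s *: v| - `|x|) / s.

Definition norm_slopes x v : set R :=
  [set norm_slope x v s | s in [set s | 0 < s]].

(** By convexity of the norm the slopes are nondecreasing in [s], so this infimum is the limit as
    [s] decreases to 0, with no limit to construct. *)
Definition norm_rderiv x v : R := inf (norm_slopes x v).

Lemma norm_slope_ge x v s : 0 < s -> - `|v| <= norm_slope x v s.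
Proof.
move=> s0; rewrite /norm_slope ler_pdivlMr// lerBrDl mulNr.
have -> : `|v| * s = `|s *: v| by rewrite normrZ gtr0_norm// mulrC.
by rewrite lerBlDr -{1}(addrK (s *: v) x) ler_normB.
Qed.

Lemma norm_slopes_has_inf x v : has_inf (norm_slopes x v).
Proof.
split; first by exists (norm_slope x v 1), 1 => //=; exact: ltr01.
by exists (- `|v|) => _ [s s0 <-]; exact: norm_slope_ge.
Qed.

Lemma norm_rderiv_le x v s : 0 < s -> norm_rderiv x v <= norm_slope x v s.
Proof.
by move=> s0; apply: ge_inf; [case: (norm_slopes_has_inf x v)|exists s].
Qed.

Lemma le_norm_rderiv x v a :
  (forall s, 0 < s -> a <= norm_slope x v s) -> a <= norm_rderiv x v.
Proof.
move=> h; apply: lb_le_inf; first by case: (norm_slopes_has_inf x v).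
by move=> _ [s s0 <-]; exact: h.
Qed.

Lemma norm_rderiv_le_norm x v : norm_rderiv x v <= `|v|.
Proof.
rewrite (le_trans (norm_rderiv_le x v ltr01))// /norm_slope scale1r divr1.
by rewrite lerBlDl ler_normD.
Qed.

(** The slope at [s = 1] is already [-|x|]. Once oddness is known, this shows that the derivative at
    [x] norms [x]. *)
Lemma norm_rderivNself x : norm_rderiv x (- x) <= - `|x|.
Proof.
rewrite (le_trans (norm_rderiv_le x (- x) ltr01))// /norm_slope scale1r divr1.
by rewrite subrr normr0 sub0r.
Qed.

(* Weights: with r = st/(s+t), x + r(v+w) is the convex combination of x + sv
   and x + tw with coefficients t/(s+t) and s/(s+t). *)
Lemma norm_rderivD x v w :
  norm_rderiv x (v + w) <= norm_rderiv x v + norm_rderiv x w.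
Proof.
rewrite -lerBlDr; apply: le_norm_rderiv => s s0.
rewrite lerBlDl -lerBlDr; apply: le_norm_rderiv => t t0.
have st0 : 0 < s + t by exact: addr_gt0.
have r0 : 0 < s * t / (s + t) by rewrite divr_gt0// mulr_gt0.
rewrite lerBlDl (le_trans (norm_rderiv_le x (v + w) r0))//.
rewrite /norm_slope ler_pdivrMr//.
have -> : x + (s * t / (s + t)) *: (v + w) =
    (t / (s + t)) *: (x + s *: v) + (s / (s + t)) *: (x + t *: w).
  rewrite !scalerDr !scalerA addrACA -scalerDl -mulrDl (addrC t s).
  rewrite divff ?gt_eqF// scale1r; congr (_ + (_ *: _ + _ *: _)).
    by ring.
  by ring.
have := ler_normD ((t / (s + t)) *: (x + s *: v))
  ((s / (s + t)) *: (x + t *: w)).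
rewrite !(@normrZ _ V) (gtr0_norm (divr_gt0 t0 st0)) (gtr0_norm (divr_gt0 s0 st0)).
rewrite lerBlDr => /le_trans; apply.
rewrite le_eqVlt; apply/orP; left; apply/eqP.
by field; rewrite ?gt_eqF.
Qed.

Lemma norm_rderiv0 x : norm_rderiv x 0 = 0.
Proof.
apply/eqP; rewrite eq_le; apply/andP; split.
  by rewrite (le_trans (norm_rderiv_le_norm _ _))// normr0.
by apply: le_norm_rderiv => s s0; rewrite /norm_slope scaler0 addr0 subrr mul0r.
Qed.

Lemma norm_rderivZ_le x v a : 0 < a ->
  norm_rderiv x (a *: v) <= a * norm_rderiv x v.
Proof.
move=> a0; rewrite -ler_pdivrMl//; apply: le_norm_rderiv => s s0.
rewrite ler_pdivrMl// (le_trans (norm_rderiv_le x _ (divr_gt0 s0 a0)))//.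
rewrite /norm_slope scalerA divfK ?gt_eqF//.
by rewrite le_eqVlt; apply/orP; left; apply/eqP; field; rewrite ?gt_eqF.
Qed.

Lemma norm_rderivZ_ge0 x v a : 0 <= a ->
  norm_rderiv x (a *: v) = a * norm_rderiv x v.
Proof.
rewrite le_eqVlt => /predU1P[<-|a0].
  by rewrite scale0r norm_rderiv0 mul0r.
apply/eqP; rewrite eq_le norm_rderivZ_le//=.
(* The reverse inequality is the same one for [a^-1] and [a *: v]. *)
have := @norm_rderivZ_le x (a *: v) a^-1.
rewrite scalerA mulVf ?gt_eqF// scale1r invr_gt0 => /(_ a0).
by rewrite ler_pdivlMl.
Qed.

End norm_slope.

(** * Linearity of the derivative under uniform smoothness *)

Section uniform_smoothness.
Context {R : realType} {V : normedModType R}.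
Hypothesis V_smooth : uniformly_smooth V.
Implicit Types (x y v w : V).

Lemma uniformly_smooth_homogeneous (e : R) : 0 < e -> exists2 d : R, 0 < d &
  forall x y, `|y| <= d * `|x| -> `|x + y| + `|x - y| <= 2 * `|x| + e * `|y|.
Proof.
move=> /V_smooth[d d0 hd]; exists d => // x y.
have [->|x0] := eqVneq x 0.
  rewrite normr0 mulr0 normr_le0 => /eqP ->.
  by rewrite subr0 addr0 normr0 !mulr0 addr0.
have nx0 : 0 < `|x| by rewrite normr_gt0.
move=> yx; have := hd (`|x|^-1 *: x) (`|x|^-1 *: y).
rewrite -scalerDr -scalerBr !normrZ normfV normr_id mulVf ?gt_eqF//.
move=> /(_ erefl); rewrite ler_pdivrMl// mulrC => /(_ yx).
rewrite -mulrDr ler_pdivrMl//.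
by move=> /le_trans; apply; rewrite mulrDr [`|x| * 2]mulrC (mulrCA `|x|) mulVKf ?gt_eqF.
Qed.

(** Subadditivity gives one inequality. For the other, smoothness bounds the sum of the slopes along
    [v] and [-v] by any [e > 0]. *)
Lemma norm_rderivN x v : x != 0 -> norm_rderiv x (- v) = - norm_rderiv x v.
Proof.
move=> x0; have nx0 : 0 < `|x| by rewrite normr_gt0.
apply/eqP; rewrite eq_le; apply/andP; split; last first.
  by have := norm_rderivD x v (- v); rewrite subrr norm_rderiv0 -lerBlDl sub0r.
rewrite -subr_le0 opprK.
have [->|v0] := eqVneq v 0; first by rewrite oppr0 norm_rderiv0 addr0.
have nv0 : 0 < `|v| by rewrite normr_gt0.
apply/ler_addgt0Pl => e e0; rewrite addr0.
(* The error [(e / |v|) |s v|] is [e s], hence [e] after division by [s]; [s] is the largest step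
   with [|s v| <= d |x|]. *)
have /uniformly_smooth_homogeneous[d d0 hd] : 0 < e / `|v| by rewrite divr_gt0.
have s0 : 0 < d * `|x| / `|v| by rewrite divr_gt0// mulr_gt0.
set s := d * `|x| / `|v| in s0.
have nsv : `|s *: v| = s * `|v| by rewrite normrZ gtr0_norm.
have := hd x (s *: v); rewrite nsv divfK ?gt_eqF// => /(_ (lexx _)).
have -> : e / `|v| * (d * `|x|) = e * s by rewrite /s; field; rewrite gt_eqF.
move=> hs; rewrite (le_trans (lerD (norm_rderiv_le _ _ s0) (norm_rderiv_le _ _ s0)))//.
rewrite /norm_slope -mulrDl ler_pdivrMr// scalerN; lra.
Qed.

(** Oddness reverses subadditivity: apply it to [u = (u + u') - u']. *)
Lemma norm_rderiv_linear x : x != 0 -> linear (norm_rderiv x : V -> R^o).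
Proof.
move=> x0 a v w.
have D u u' : norm_rderiv x (u + u') = norm_rderiv x u + norm_rderiv x u'.
  apply/eqP; rewrite eq_le norm_rderivD/= -lerBrDr -norm_rderivN//.
  by rewrite (le_trans _ (norm_rderivD _ _ _))// addrK.
rewrite D; congr (_ + _).
have [a0|a0] := leP 0 a; first exact: norm_rderivZ_ge0.
rewrite -[a *: v]opprK -scaleNr norm_rderivN// norm_rderivZ_ge0 ?oppr_ge0 ?ltW//.
by rewrite mulNr opprK.
Qed.

Lemma norm_rderiv_bounded x v : x != 0 -> `|norm_rderiv x v| <= `|v|.
Proof.
move=> x0; rewrite ler_norml norm_rderiv_le_norm andbT lerNl -norm_rderivN//.
by rewrite (le_trans (norm_rderiv_le_norm _ _)) ?normrN.
Qed.

(* Smoothness replaces the Hahn-Banach theorem: the derivative of the norm at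
   [x] is a norming functional. *)
Lemma norming_functional x : exists g : dual V, `|g| <= 1 /\ g x = `|x|.
Proof.
have [->|x0] := eqVneq x 0.
  by exists 0; rewrite normr0 ler01 normr0.
have pl := norm_rderiv_linear x0.
have p_cl : (norm_rderiv x : V -> R^o) \in @continuous_linear R V.
  apply/continuous_linearP; split => // v.
  apply/cvgrPdist_lt => e e0; near=> w.
  have -> : (norm_rderiv x v : R^o) - norm_rderiv x w = norm_rderiv x (v - w).
    have := pl (-1) w v; rewrite scaleN1r [- w + v]addrC => ->.
    by rewrite scaleN1r addrC.
  apply: le_lt_trans (norm_rderiv_bounded _ x0) _.
  by near: w; apply: cvgr_dist_lt.
exists (Dual p_cl); split.
  apply: dual_norm_le => v v1 /=.
  exact: le_trans (norm_rderiv_bounded _ x0) v1.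
apply/eqP; rewrite eq_le norm_rderiv_le_norm/= -lerN2.
by rewrite -norm_rderivN// norm_rderivNself.
Unshelve. all: by end_near. Qed.

End uniform_smoothness.

Section normed_dual.
Context {R : realType} {V : normedModType R}.

Lemma dual_norm_apply (g : dual V) v : `|g v| <= `|g| * `|v|.
Proof.
have [->|v0] := eqVneq v 0; first by rewrite dual0v !normr0 mulr0.
have nv0 : 0 < `|v| by rewrite normr_gt0.
have : `|g (`|v|^-1 *: v)| <= `|g|.
  by apply: dual_norm_ub; rewrite normrZ normfV normr_id mulVf ?gt_eqF.
by rewrite dualZv normrM normfV normr_id ler_pdivrMl// mulrC.
Qed.

Lemma dual_normed_le (g : dual V) v : `|g| <= 1 -> `|g v| <= `|v|.
Proof.
move=> g1; rewrite (le_trans (dual_norm_apply g v))//.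
by rewrite ler_piMl.
Qed.

Lemma dualDv (g : dual V) v w : g (v + w) = g v + g w.
Proof. by have := dual_linear g 1 v w; rewrite !scale1r. Qed.

Lemma dualNv (g : dual V) v : g (- v) = - g v.
Proof. by rewrite -scaleN1r dualZv mulN1r. Qed.

End normed_dual.

(** * Continuity of the duality map *)

Section duality_map.
Context {R : realType} {V : normedModType R}.
Hypothesis V_smooth : uniformly_smooth V.
Variable j : V -> dual V.
Hypothesis j_le1 : forall x, `|j x| <= 1.
Hypothesis j_norm : forall x, j x x = `|x|.

(* Add j_y(x + w) <= |x + w| and j_x(x - w) <= |x - w|, with w a multiple of
   v of norm d|x|, and bound the right-hand sides by smoothness. *)
Lemma norming_continuous x : x != 0 -> {for x, continuous j}.
Proof.
move=> x0; have nx0 : 0 < `|x| by rewrite normr_gt0.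
apply/cvgrPdist_le => e e0.
have e20 : 0 < e / 2 by rewrite divr_gt0.
have [d d0 hd] := uniformly_smooth_homogeneous V_smooth e20.
have c0 : 0 < d * `|x| by rewrite mulr_gt0.
(* With [c = d |x|], replacing [j y x] by [|x|] costs at most [2 |x - y| <= e c / 2]; smoothness
   costs another [e c / 2]. *)
have dist0 : 0 < e * (d * `|x|) / 4 by rewrite divr_gt0// mulr_gt0.
near=> y.
have xy : `|x - y| <= e * (d * `|x|) / 4.
  by near: y; exact: cvgr_dist_le.
suff main v : `|v| <= 1 -> j y v - j x v <= e.
  apply: dual_norm_le => v v1.
  have -> : (j x - j y) v = j x v - j y v by [].
  rewrite ler_norml lerNl opprB main//=.
  have := main (- v); rewrite normrN => /(_ v1).
  by rewrite !dualNv; lra.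
move=> v1; have := hd x ((d * `|x|) *: v).
have nw : `|(d * `|x|) *: v| = d * `|x| * `|v| by rewrite normrZ gtr0_norm.
have le_dx : d * `|x| * `|v| <= d * `|x| by rewrite ler_piMr// ltW.
rewrite nw => /(_ le_dx) sm.
have := le_trans (ler_norm _) (dual_normed_le (x + (d * `|x|) *: v) (j_le1 y)).
have := le_trans (ler_norm _) (dual_normed_le (x - (d * `|x|) *: v) (j_le1 x)).
have := le_trans (ler_norm _) (dual_normed_le (y - x) (j_le1 y)).
rewrite (distrC y x) !(dualDv, dualNv, dualZv) !j_norm => h1 h2 h3.
have h4 : `|x| <= `|y| + `|x - y| by rewrite -{1}(subrK y x) addrC ler_normD.
have h5 : e / 2 * (d * `|x| * `|v|) <= e / 2 * (d * `|x|).
  by rewrite ler_pM2l.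
rewrite -(ler_pM2l c0); lra.
Unshelve. all: by end_near. Qed.

(** At 0, where [j] need not be continuous, [|j x| <= 1] and the factor [|x|] force the limit 0. *)
Lemma duality_map_continuous : continuous (fun x => `|x| *: j x : dual V).
Proof.
move=> x; have [->|x0] := eqVneq x 0.
  rewrite /continuous_at normr0 scale0r.
  apply/cvgrPdist_le => e e0; near=> y.
  rewrite sub0r normrN normrZ normr_id.
  apply: (@le_trans _ _ `|y|); first by rewrite ler_piMr.
  by near: y; apply: cvgr0_norm_le.
apply: cvgZ; first exact: norm_continuous.
exact: norming_continuous.
Unshelve. all: by end_near. Qed.

End duality_map.

(** If [g] norms [x] and almost norms [y], it is nearly 1 at the midpoint of their normalizations,
    so convexity makes these close. *)
Lemma uniformly_convex_norming (R : realType) (V : normedModType R) (e : R) :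
  uniformly_convex V -> 0 < e -> exists2 d : R, 0 < d &
    forall (g : dual V) (x y : V), `|g| <= 1 -> g x = `|x| ->
      (1 - d) * `|x| <= g y -> `|y| <= (1 + d) * `|x| -> `|y - x| <= e * `|x|.
Proof.
move=> V_convex e0; have e20 : 0 < e / 2 by rewrite divr_gt0.
have [d' d'0 hd'] := V_convex _ e20.
(* The three bounds serve, in turn, to contradict convexity ([1 - d > 1 - d']), to control
   [|y| - |x|], and to keep [1 - 2 d] nonnegative. *)
pose d := Num.min (d' / 2) (Num.min (e / 2) (1 / 2)).
have dd' : d <= d' / 2 by rewrite /d ge_min lexx.
have de : d <= e / 2 by rewrite /d !ge_min lexx orbT.
have d1 : d <= 1 / 2 by rewrite /d !ge_min lexx !orbT.
have d0 : 0 < d by rewrite /d !lt_min !divr_gt0.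
exists d => // g x y g1 gx gy ny.
have [x0|x0] := eqVneq x 0.
  by move: ny; rewrite x0 subr0 normr0 !mulr0.
have nx0 : 0 < `|x| by rewrite normr_gt0.
have gyn : g y <= `|y| := le_trans (ler_norm _) (dual_normed_le y g1).
have ny0 : 0 < `|y|.
  by apply: lt_le_trans gyn; apply: lt_le_trans gy; rewrite mulr_gt0//; lra.
set x' := `|x|^-1 *: x; set y' := `|y|^-1 *: y.
have nx' : `|x'| = 1 by rewrite normrZ normfV normr_id mulVf ?gt_eqF.
have ny' : `|y'| = 1 by rewrite normrZ normfV normr_id mulVf ?gt_eqF.
have gx' : g x' = 1 by rewrite dualZv gx mulVf ?gt_eqF.
(* This rests on [(1 - 2 d) (1 + d) = 1 - d - 2 d^2 <= 1 - d]. *)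
have gy' : 1 - 2 * d <= g y'.
  rewrite dualZv ler_pdivlMl//.
  have : (1 - 2 * d) * `|y| <= (1 - 2 * d) * ((1 + d) * `|x|).
    by rewrite ler_wpM2l//; lra.
  have : 0 <= d * d * `|x| by rewrite !mulr_ge0// ltW.
  lra.
have close : `|x' - y'| <= e / 2.
  rewrite leNgt; apply/negP => /ltW far.
  have := hd' x' y'; rewrite nx' ny' => /(_ erefl (lexx _) far).
  have := le_trans (ler_norm _) (dual_normed_le (2^-1 *: (x' + y')) g1).
  rewrite dualZv dualDv gx'; lra.
(* Split into a difference of lengths and one of directions, each at most [e / 2 * |x|]. *)
have -> : y - x = (`|y| - `|x|) *: y' + `|x| *: (y' - x').
  rewrite scalerBl scalerBr addrA subrK /x' /y' !scalerA !divff ?gt_eqF//.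
  by rewrite !scale1r.
rewrite (le_trans (ler_normD _ _))// (normrZ _ y') (normrZ _ (y' - x')).
rewrite ny' mulr1 normr_id distrC.
have : `| `|x| - `|y| | <= d * `|x| by rewrite ler_norml; lra.
have : `|x| * `|y' - x'| <= `|x| * (e / 2) by rewrite ler_pM2l// distrC.
have : d * `|x| <= e / 2 * `|x| by rewrite ler_pM2r.
lra.
Qed.

(** * Uniform convergence and suprema *)

Lemma uniform_cvg_dist_lt (T : choiceType) (R : realType) (A : set T)
    (F_ : nat -> T -> R) (F : T -> R) (e : R) : 0 < e ->
  {uniform A, F_ @ \oo --> F} ->
  \forall n \near \oo, forall t, A t -> `|F t - F_ n t| < e.
Proof.
move=> e0 FF; apply: (FF [set h | forall t, A t -> `|F t - h t| < e]).
apply/uniform_nbhs.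
exists [set xy | ball xy.1 e xy.2]; split; first exact: (entourage_ball _ (PosNum e0)).
by move=> h /= hA t At; exact: hA.
Qed.

(** A point of [A] keeps the supremum nonnegative, where the empty set would give [-oo]; the bound
    with [e = 1] makes it eventually finite. *)
Lemma cvg_ereal_sup_norm0 (T : Type) (R : realType) (V : normedModType R)
    (A : set T) (g_ : nat -> T -> V) : A !=set0 ->
  (forall e : R, 0 < e -> \forall n \near \oo, forall t, A t -> `|g_ n t| <= e) ->
  ereal_sup [set (`|g_ n t|)%:E | t in A] @[n --> \oo] --> 0%E.
Proof.
move=> [t0 At0] gA.
have sup_bounds n (e : R) : (forall t, A t -> `|g_ n t| <= e) ->
    (0 <= ereal_sup [set (`|g_ n t|)%:E | t in A] <= e%:E)%E.
  move=> le_e; apply/andP; split.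
    apply: (@le_trans _ _ (`|g_ n t0|)%:E); first by rewrite lee_fin.
    by apply: ereal_sup_ubound; exists t0.
  by apply: ge_ereal_sup => _ [t At <-]; rewrite lee_fin le_e.
apply/fine_cvgP; split.
  near=> n; have /sup_bounds/andP[s0 s1] : forall t, A t -> `|g_ n t| <= 1.
    by near: n; exact: gA.
  by rewrite fin_numElt (lt_le_trans _ s0) ?ltNyr// (le_lt_trans s1) ?ltry.
apply/cvgrPdist_le => e e0; near=> n.
have /sup_bounds/andP[s0 s1] : forall t, A t -> `|g_ n t| <= e.
  by near: n; exact: gA.
rewrite sub0r normrN /= ger0_norm ?fine_ge0//.
by rewrite -lee_fin fineK// fin_numElt (lt_le_trans _ s0) ?ltNyr// (le_lt_trans s1) ?ltry.
Unshelve. all: by end_near. Qed.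

Theorem theorem4 (R : realType) (T : R) (hT : 0 < T)
  (V : completeNormedModType R)
  (hconvex : uniformly_convex V) (hsmooth : uniformly_smooth V)
  (f_ : nat -> R -> V) (f : R -> V)
  (hf_ : forall n, {within `[0, T], continuous (f_ n)})
  (hf : {within `[0, T], continuous f})
  (hnorm : {uniform `[0, T],
     (fun n t => `|f_ n t|) @ \oo --> (fun t => `|f t|)})
  (hweak : forall phi : R -> dual V, {within `[0, T], continuous phi} ->
     {uniform `[0, T],
       (fun n t => phi t (f_ n t)) @ \oo --> (fun t => phi t (f t))}) :
  ereal_sup [set (`|f_ n t - f t|)%:E | t in `[0, T]] @[n --> \oo] --> 0%E.
Proof.
(* Any selection will do: smoothness makes each one continuous away from 0. *)
have [j jP] := choice (norming_functional hsmooth).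
have j_le1 x := (jP x).1; have j_norm x := (jP x).2.
have J_cont : {within `[0, T], continuous (fun t => `|f t| *: j (f t) : dual V)}.
  move=> t; apply: (@cvg_comp _ _ _ f (fun x => `|x| *: j x) _ _ _ (hf t)).
  exact: (duality_map_continuous hsmooth j_le1 j_norm).
have : compact (f @` `[0, T]).
  by apply: continuous_compact => //; exact: segment_compact.
move=> /compact_bounded/pinfty_ex_gt0[M M0 fM].
apply: cvg_ereal_sup_norm0.
  by exists 0; rewrite /= in_itv/= lexx ltW.
move=> e e0.
(* The estimate is relative to [|f t| <= M], so [e / M] yields the absolute error [e]. *)
have [d d0 hd] := uniformly_convex_norming hconvex (divr_gt0 e0 M0).
have r0 : 0 < e / 4 by rewrite divr_gt0.
(* The first bound gives error below [3 e / 4] where [|f t| < e / 4]; the second gives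
   [|f_ n t| <= (1 + d) |f t|] elsewhere. *)
have m0 : 0 < Num.min (e / 4) (d * (e / 4)) by rewrite lt_min r0 mulr_gt0.
have q0 : 0 < d * (e / 4) ^+ 2 by rewrite mulr_gt0// exprn_gt0.
near=> n => t tT.
have hn : `| `|f t| - `|f_ n t| | < Num.min (e / 4) (d * (e / 4)).
  by move: t tT; near: n; exact: uniform_cvg_dist_lt hnorm.
have hw : `| `|f t| * j (f t) (f t) - `|f t| * j (f t) (f_ n t)| < d * (e / 4) ^+ 2.
  by move: t tT {hn}; near: n; exact: uniform_cvg_dist_lt (hweak _ J_cont).
move: hn; rewrite lt_min !ltr_distlC => /andP[/andP[_ hn1] /andP[_ hn2]].
have [small|large] := ltP `|f t| (e / 4).
  by rewrite (le_trans (ler_normB _ _))//; lra.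
have ft0 : 0 < `|f t| by exact: lt_le_trans large.
have dl : d * (e / 4) <= d * `|f t| by rewrite ler_pM2l.
have dl2 : d * (e / 4) ^+ 2 <= d * `|f t| ^+ 2.
  by rewrite ler_pM2l// lerXn2r ?nnegrE// ltW.
rewrite (@le_trans _ _ (e / M * `|f t|))//; last first.
  by rewrite mulrAC ler_pdivrMr// ler_pM2l// fM//; exists t.
apply: (hd (j (f t))) => //; last by lra.
(* The pairing error is below [d |f t|^2]; dividing by [|f t|] leaves [d |f t|]. *)
move: hw; rewrite ltr_distlC j_norm => /andP[hw _].
rewrite -(ler_pM2l ft0); lra.
Unshelve. all: by end_near. Qed.
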